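(* Let $\{\mathfrak H,\mathfrak K,\Gamma_0,\Gamma_1,\widetilde\Gamma_0,\widetilde\Gamma_1\}$ be a boundary triplet for an adjoint pair $A,\widetilde A$, and let $\mathcal A_j$, $j=1,2$, be any two closed extensions of $A$ acting in $\mathcal H$ and satisfying $A\subseteq\mathcal A_j\subseteq(\widetilde A)^*$. Suppose that $\zeta\in\mathbb C\setminus(\mathrm{Spec}(\mathcal A_1)\cup\mathrm{Spec}(\mathcal A_2))$ and denote $R_j(\zeta):=(\mathcal A_j-\zeta)^{-1}$, $j=1,2$, and $R_2^*(\zeta):=((\mathcal A_2)^*-\overline\zeta)^{-1}$. Then $$R_2(\zeta)-R_1(\zeta)=\big(\widetilde\Gamma_0R_2^*(\zeta)\big)^*\Gamma_1R_1(\zeta)-\big(\widetilde\Gamma_1R_2^*(\zeta)\big)^*\Gamma_0R_1(\zeta),$$ $$R_2(\zeta)-R_1(\zeta)=\big(\widetilde{\mathrm T}R_2^*(\zeta)\big)^*Q_2JQ_1\big(\mathrm TR_1(\zeta)\big),$$ where $\widetilde{\mathrm T}R_2^*(\zeta)=(\widetilde\Gamma_0R_2^*(\zeta),\widetilde\Gamma_1R_2^*(\zeta))$ is considered as an operator in $\mathcal B(\mathcal H,\mathfrak K\times\mathfrak H)$ and the adjoints are defined correspondingly, $Q_1$ is the orthogonal projection onto $\overline{\mathrm T(\mathrm{dom}(\mathcal A_1))}$ in $\mathfrak H\times\mathfrak K$, $Q_2$ is the orthogonal projection onto $\overline{\widetilde{\mathrm T}(\mathrm{dom}((\mathcal A_2)^*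 ))}$ in $\mathfrak K\times\mathfrak H$, and $J$ maps a pair $(f,g)\in\mathfrak H\times\mathfrak K$ to $(g,-f)\in\mathfrak K\times\mathfrak H$.
   Context: $\mathcal H,\mathfrak H,\mathfrak K$ are Hilbert spaces; inner products are linear in the first argument. $A,\widetilde A$ are closed densely defined operators in $\mathcal H$ forming an adjoint pair: $\widetilde A\subseteq A^*$ and $A\subseteq(\widetilde A)^*$. $\mathcal H_+=\mathrm{dom}(A^* )$ and $\widetilde{\mathcal H}_+=\mathrm{dom}((\widetilde A)^* )$ carry the graph norms of $A^*$ and $(\widetilde A)^*$. A boundary triplet for the adjoint pair is a collection of linear operators $\Gamma_0:\widetilde{\mathcal H}_+\to\mathfrak H$, $\Gamma_1:\widetilde{\mathcal H}_+\to\mathfrak K$, $\widetilde\Gamma_0:\mathcal H_+\to\mathfrak K$, $\widetilde\Gamma_1:\mathcal H_+\to\mathfrak H$ such that the trace operators $\mathrm T:=[\Gamma_0,\Gamma_1]^\top:\widetilde{\mathcal H}_+\to\mathfrak H\times\mathfrak K$ and $\widetilde{\mathrm T}:=[\widetilde\Gamma_0,\widetilde\Gamma_1]^\top:\mathcal H_+\to\mathfrak K\times\mathfrak H$ are surjective and $$\langle(\widetilde A)^*u,v\rangle_{\mathcal H}-\langle u,A^*v\rangle_{\mathcal H}=\langle\Gamma_1u,\widetilde\Gamma_0v\rangle_{\mathfrak K}-\langle\Gamma_0u,\widetilde\Gamma_1v\rangle_{\mathfrak H}\quad\text{for all }u\in\widetilde{\mathcal H}_+,\ v\in\mathcal H_+.$$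 It is known that $\mathrm T,\widetilde{\mathrm T}$ are then bounded. *)

(* Defs.v *)
From HB Require Import structures.
From mathcomp Require Import all_boot all_order all_algebra.
From mathcomp Require Import complex.
From mathcomp Require Import boolp classical_sets functions reals.
From mathcomp Require Import topology normedtype.
From mathcomp Require Import ring.

Set Implicit Arguments.
Unset Strict Implicit.
Unset Printing Implicit Defensive.

Import Order.TTheory GRing.Theory Num.Theory.
Import numFieldNormedType.Exports.

Local Open Scope classical_set_scope.
Local Open Scope ring_scope.

(* Complex Hilbert spaces, the inner product being linear in its first argument. *)
HB.mixin Record CompleteNormedModule_isHilbert (R : realType) H
    & CompleteNormedModule R[i] H := {
  inner : {dot H for (@Num.conj R[i])};
  inner_normE : forall u : H, inner u u = `|u| ^+ 2
}.

#[short(type="hilbertType")]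
HB.structure Definition Hilbert (R : realType) :=
  {H of CompleteNormedModule_isHilbert R H & CompleteNormedModule R[i] H}.

Notation "''[' u , v ]" := (inner u v)
  (at level 0, format "''[' u ,  v ]") : ring_scope.

(* The Hilbert space direct sum: an alias of [H * K], whose own norm is the sup
   norm and therefore does not come from an inner product. *)
Definition hsum (R : realType) (H K : hilbertType R) : Type := (H * K)%type.

Section HilbertSum.
Variables (R : realType) (H K : hilbertType R).

HB.instance Definition _ := GRing.Lmodule.copy (hsum H K) (H * K)%type.

Definition hsum_inner (p q : hsum H K) : R[i] := '[p.1, q.1] + '[p.2, q.2].

Lemma hsum_inner_bilinear :
  bilinear_for *%R (@Num.conj R[i] \; *%R) hsum_inner.
Proof.
split=> [q|q] a u v; rewrite /hsum_inner /= ?linearPl ?linearPr /= mulrDr.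
- by rewrite addrACA.
- by rewrite addrACA.
Qed.

HB.instance Definition _ := bilinear_isBilinear.Build _ _ _ _ _ _ hsum_inner
  hsum_inner_bilinear.

Lemma hsum_inner_sym (u v : hsum H K) :
  hsum_inner u v = (-1) ^+ false * Num.conj (hsum_inner v u).
Proof.
rewrite /hsum_inner expr0 mul1r rmorphD /=.
by congr (_ + _); rewrite [LHS]hermC /= expr0 mul1r.
Qed.

HB.instance Definition _ := isHermitianSesquilinear.Build _ _ _ _ hsum_inner
  hsum_inner_sym.

Lemma hsum_inner_gt0 (u : hsum H K) : u != 0 -> 0 < hsum_inner u u.
Proof.
case: u => x y; rewrite /hsum_inner /= => xy0; rewrite !inner_normE.
rewrite lt_def addr_ge0 ?exprn_ge0// andbT paddr_eq0 ?exprn_ge0//.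
rewrite !expf_eq0 /= !normr_eq0.
by apply: contra xy0 => /andP[/eqP-> /eqP->].
Qed.

HB.instance Definition _ := isDotProduct.Build _ _ hsum_inner hsum_inner_gt0.

Definition hsum_norm (p : hsum H K) : R[i] := sqrtC (`|p.1| ^+ 2 + `|p.2| ^+ 2).

Lemma hsum_normE (p : hsum H K) : hsum_norm p ^+ 2 = hsum_inner p p.
Proof. by rewrite sqrtCK /hsum_inner !inner_normE. Qed.


Lemma hsum_norm_ge0 (p : hsum H K) : 0 <= hsum_norm p.
Proof. by rewrite sqrtC_ge0 addr_ge0 ?exprn_ge0. Qed.

Lemma ler_hsum_norm (p : hsum H K) :
  `|p.1| <= hsum_norm p /\ `|p.2| <= hsum_norm p.
Proof.
split; rewrite -(@ler_pXn2r _ 2)// ?nnegrE ?hsum_norm_ge0// sqrtCK.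
- by rewrite lerDl exprn_ge0.
- by rewrite lerDr exprn_ge0.
Qed.

Lemma hsum_norm_le (p : hsum H K) : hsum_norm p <= `|p.1| + `|p.2|.
Proof.
rewrite -(@ler_pXn2r _ 2)// ?nnegrE ?hsum_norm_ge0 ?addr_ge0// sqrtCK.
by rewrite sqrrD lerD2r lerDl mulrn_wge0// mulr_ge0.
Qed.

Lemma hsum_normD (p q : hsum H K) :
  hsum_norm (p + q) <= hsum_norm p + hsum_norm q.
Proof.
rewrite -(@ler_pXn2r _ 2)// ?nnegrE ?addr_ge0 ?hsum_norm_ge0//.
rewrite sqrrD !sqrtCK.
set a := `|p.1|; set b := `|p.2|; set c := `|q.1|; set d := `|q.2|.
have [a0 b0 c0 d0] : [/\ 0 <= a, 0 <= b, 0 <= c & 0 <= d].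
  by split; exact: normr_ge0.
apply: (@le_trans _ _ ((a + c) ^+ 2 + (b + d) ^+ 2)).
  by apply: lerD; rewrite ler_pXn2r ?nnegrE ?addr_ge0// ler_normD.
have cs : a * c + b * d <= hsum_norm p * hsum_norm q.
  rewrite -(@ler_pXn2r _ 2)// ?nnegrE ?addr_ge0 ?mulr_ge0 ?hsum_norm_ge0//.
  rewrite exprMn !sqrtCK -subr_ge0.
  have -> : (a ^+ 2 + b ^+ 2) * (c ^+ 2 + d ^+ 2) - (a * c + b * d) ^+ 2
          = (a * d - b * c) ^+ 2 by ring.
  by apply: real_exprn_even_ge0 => //; apply: rpredB; apply: ger0_real; exact: mulr_ge0.
have -> : (a + c) ^+ 2 + (b + d) ^+ 2
  = (a ^+ 2 + b ^+ 2) + (a * c + b * d) *+ 2 + (c ^+ 2 + d ^+ 2) by ring.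
by rewrite lerD2r lerD2l lerMn2r cs orbT.
Qed.

Lemma hsum_normZ (l : R[i]) (p : hsum H K) :
  hsum_norm (l *: p) = `|l| * hsum_norm p.
Proof.
rewrite /hsum_norm !normrZ !exprMn -mulrDr sqrtCM ?nnegrE ?exprn_ge0//.
  by rewrite sqrCK ?normr_ge0.
by rewrite addr_ge0 ?exprn_ge0.
Qed.

Lemma hsum_norm0_eq0 (p : hsum H K) : hsum_norm p = 0 -> p = 0.
Proof.
case: p => x y p0; have [] := ler_hsum_norm (x, y).
by rewrite p0 !normr_le0 /= => /eqP -> /eqP ->.
Qed.

HB.instance Definition _ := Lmodule_isNormed.Build R[i] (hsum H K)
  hsum_normD hsum_normZ hsum_norm0_eq0.

Lemma hsum_complete (F : set_system (hsum H K)) :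
  ProperFilter F -> cauchy F -> cvg F.
Proof.
move=> FF Fc.
have cauchy1 : cauchy (fst @ F : set_system H).
  apply/cauchyP => e e0; have /cauchyP /(_ e e0)[p Fp] := Fc.
  exists p.1; change (F (fun q : hsum H K => ball p.1 e q.1)).
  apply: filterS Fp => q; rewrite -!ball_normE /=.
  by apply: le_lt_trans; have [] := ler_hsum_norm (p - q).
have cauchy2 : cauchy (snd @ F : set_system K).
  apply/cauchyP => e e0; have /cauchyP /(_ e e0)[p Fp] := Fc.
  exists p.2; change (F (fun q : hsum H K => ball p.2 e q.2)).
  apply: filterS Fp => q; rewrite -!ball_normE /=.
  by apply: le_lt_trans; have [] := ler_hsum_norm (p - q).
have l1P : cvg (fst @ F : set_system H)
  by exact: cauchy_cvg.
have l2P : cvg (snd @ F : set_system K)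
  by exact: cauchy_cvg.
suff FP : F --> ((lim (fst @ F : set_system H),
                  lim (snd @ F : set_system K)) : hsum H K).
  by apply/cvg_ex; eexists; exact: FP.
apply/cvgrPdist_lt => e e0.
have e20 : 0 < e / 2 by rewrite divr_gt0.
have {}l1P : \forall p \near F, `|lim (fst @ F : set_system H) - p.1| < e / 2.
  by move/cvgrPdist_lt: l1P => /(_ _ e20).
have {}l2P : \forall p \near F, `|lim (snd @ F : set_system K) - p.2| < e / 2.
  by move/cvgrPdist_lt: l2P => /(_ _ e20).
near=> p.
apply: (le_lt_trans (hsum_norm_le _)); rewrite [e]splitr ltrD//=.
- by near: p.
- by near: p.
Unshelve. all: by end_near. Qed.

HB.instance Definition _ := Uniform_isComplete.Build (hsum H K) hsum_complete.

Lemma hsum_inner_normE (p : hsum H K) : hsum_inner p p = `|p| ^+ 2.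
Proof. by rewrite -hsum_normE. Qed.

HB.instance Definition _ := CompleteNormedModule_isHilbert.Build R (hsum H K)
  hsum_inner_normE.

Lemma hsum_innerE (p q : hsum H K) : '[p, q] = '[p.1, q.1] + '[p.2, q.2].
Proof. by []. Qed.

End HilbertSum.

(* A (possibly unbounded, partially defined) operator from [H] to [K] is given by
   its graph, a set of [H * K]: then equality of operators includes equality of
   domains, [S `<=` T] says that [T] extends [S], and [closed] is the usual
   closedness. The operations below are those of linear relations. *)
Section Operators.
Variable R : realType.

Section Graphs.
Variables H K : hilbertType R.
Implicit Types S T : set (H * K).

Definition linear_operator S :=
  [/\ S 0,
      forall (a : R[i]) p q, S p -> S q -> S (a *: p + q) &
      forall x y y', S (x, y) -> S (x, y') -> y = y'].

Definition op_dom S : set H := [set x | exists y, S (x, y)].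

Definition op_image S (V : set H) : set K := [set y | exists2 x, V x & S (x, y)].

Definition op_graph (f : H -> K) : set (H * K) := [set p | p.2 = f p.1].

Definition op_inv S : set (K * H) := [set p | S (p.2, p.1)].

Definition op_sub S T : set (H * K) :=
  [set p | exists u v, [/\ S (p.1, u), T (p.1, v) & p.2 = u - v]].

Definition op_adjoint S : set (K * H) :=
  [set p | forall x y, S (x, y) -> '[y, p.1] = '[x, p.2]].

(* S belongs to B(H, K) *)
Definition bounded_operator S :=
  [/\ linear_operator S, op_dom S = setT &
      exists M : R, forall x y, S (x, y) -> `|y| <= M%:C%C * `|x|].

End Graphs.

(* [op_comp S T] applies [T] first *)
Definition op_comp (H K L : hilbertType R) (S : set (K * L)) (T : set (H * K)) :
    set (H * L) :=
  [set p | exists2 y, T (p.1, y) & S (y, p.2)].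

Definition op_pair (H K L : hilbertType R) (S : set (H * K)) (T : set (H * L)) :
    set (H * hsum K L) :=
  [set p | S (p.1, p.2.1) /\ T (p.1, p.2.2)].

Section Spectrum.
Variable H : hilbertType R.
Implicit Types A : set (H * H).

Definition resolvent A (z : R[i]) : set (H * H) :=
  op_inv (op_sub A (op_graph (fun x : H => z *: x))).

Definition spectrum A : set R[i] := [set z | ~ bounded_operator (resolvent A z)].

Definition orthogonal_projection (V : set H) : set (H * H) :=
  [set p | V p.2 /\ forall v, V v -> '[p.1 - p.2, v] = 0].

End Spectrum.

End Operators.

Declare Scope operator_scope.
Delimit Scope operator_scope with OP.
Notation "S * T" := (op_comp S T) : operator_scope.
Notation "S - T" := (op_sub S T) : operator_scope.
Notation "S ^*" := (op_adjoint S) : operator_scope.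

Section BoundaryTriplet.
Variables (R : realType) (H hh kk : hilbertType R).

Definition adjoint_pair (A At : set (H * H)) :=
  [/\ [/\ linear_operator A, closed A & dense (op_dom A)],
      [/\ linear_operator At, closed At & dense (op_dom At)],
      At `<=` op_adjoint A & A `<=` op_adjoint At].

(* [At], [Gt0], [Gt1] carry the tilde; [hh] and [kk] are the boundary spaces. *)
Record boundary_triplet (A At : set (H * H))
    (G0 : set (H * hh)) (G1 : set (H * kk))
    (Gt0 : set (H * kk)) (Gt1 : set (H * hh)) : Prop := {
  triplet_linear : [/\ linear_operator G0, linear_operator G1,
                       linear_operator Gt0 & linear_operator Gt1];
  triplet_dom : [/\ op_dom G0 = op_dom (op_adjoint At),
                    op_dom G1 = op_dom (op_adjoint At),
                    op_dom Gt0 = op_dom (op_adjoint A) &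
                    op_dom Gt1 = op_dom (op_adjoint A)];
  triplet_trace_surj : op_image (op_pair G0 G1) setT = setT;
  triplet_tracet_surj : op_image (op_pair Gt0 Gt1) setT = setT;
  triplet_Green : forall u Atu v Av g0u g1u gt0v gt1v,
    op_adjoint At (u, Atu) -> op_adjoint A (v, Av) ->
    G0 (u, g0u) -> G1 (u, g1u) -> Gt0 (v, gt0v) -> Gt1 (v, gt1v) ->
    '[Atu, v] - '[u, Av] = '[g1u, gt0v] - '[g0u, gt1v]
}.

Definition symplectic_swap (p : hsum hh kk) : hsum kk hh := (p.2, - p.1).

End BoundaryTriplet.

(* Main.v *)
(* Green's identity, applied to u in dom (At^* ) and v = R2^*(zeta) y, reads
     <R2(zeta) (At^* - zeta) u - u, y> = <G1 u, Gt0 v> - <G0 u, Gt1 v>,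
   that is, R2(zeta) (At^* - zeta) u - u is the image of J (G0 u, G1 u) under
   (Tt R2^*(zeta))^*. For u = R1(zeta) x the left-hand vector is
   R2(zeta) x - R1(zeta) x, which gives both formulas: Q1 fixes T u, and Q2 only
   removes a component orthogonal to the range of Tt R2^*(zeta). Since T is
   surjective, the identity also shows that (Tt R2^*(zeta))^* is everywhere
   defined, so that Tt R2^*(zeta) is bounded by the uniform boundedness
   principle, and no continuity of the traces has to be established first. *)
Require Import Defs.
From HB Require Import structures.
From mathcomp Require Import all_boot all_order all_algebra.
From mathcomp Require Import complex.
From mathcomp Require Import boolp classical_sets functions reals.
From mathcomp Require Import topology normedtype.
From mathcomp Require Import ring lra.

Set Implicit Arguments.
Unset Strict Implicit.
Unset Printing Implicit Defensive.

Import Order.TTheory GRing.Theory Num.Theory.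
Import numFieldNormedType.Exports.

Local Open Scope classical_set_scope.
Local Open Scope ring_scope.

(** * Inner products: Cauchy-Schwarz, real tolerances and limits with a rate *)

Section InnerProduct.
Variables (R : realType) (H : hilbertType R).
Implicit Types (u v w x : H) (a : R[i]).

Lemma innerC u v : '[u, v] = Num.conj '[v, u].
Proof. by rewrite [LHS]hermC /= expr0 mul1r. Qed.

Lemma innerBl u v w : '[u - v, w] = '[u, w] - '[v, w].
Proof. by rewrite linearBl. Qed.

Lemma innerBr u v w : '[w, u - v] = '[w, u] - '[w, v].
Proof. by rewrite linearBr. Qed.

Lemma innerDr u v w : '[w, u + v] = '[w, u] + '[w, v].
Proof. by rewrite linearDr. Qed.

Lemma innerDl u v w : '[u + v, w] = '[u, w] + '[v, w].
Proof. by rewrite linearDl. Qed.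

Lemma innerZl a u v : '[a *: u, v] = a * '[u, v].
Proof. by rewrite linearZl_LR. Qed.

Lemma innerZr a u v : '[u, a *: v] = Num.conj a * '[u, v].
Proof. by rewrite linearZr_LR. Qed.

Lemma inner0l v : '[0, v] = 0 :> R[i].
Proof. by rewrite linear0l. Qed.

Lemma inner0r v : '[v, 0] = 0 :> R[i].
Proof. by rewrite linear0r. Qed.

Lemma inner_eq0 u : '[u, u] = 0 -> u = 0.
Proof. by rewrite inner_normE => /eqP; rewrite sqrf_eq0 normr_eq0 => /eqP. Qed.

Lemma inner_inj u v : (forall x, '[x, u] = '[x, v]) -> u = v.
Proof.
by move=> uv; apply/subr0_eq/inner_eq0; rewrite innerBr uv subrr.
Qed.

(* The minimum of [`|u - t v|^2] over scalars [t], cleared of denominators. *)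
Lemma inner_sqr_min u v : exists t : R[i],
  `|u - t *: v| ^+ 2 * `|v| ^+ 2 = `|u| ^+ 2 * `|v| ^+ 2 - `|'[u, v]| ^+ 2.
Proof.
have [->|v0] := eqVneq v 0.
  by exists 0; rewrite inner0r !normr0 !expr0n/= !mulr0 subr0.
have vv0 : '[v, v] != 0 by rewrite inner_normE expf_neq0// normr_eq0.
exists ('[u, v] / '[v, v]); rewrite -!inner_normE.
have orth : '[u - '[u, v] / '[v, v] *: v, v] = 0.
  by rewrite innerBl innerZl divfK// subrr.
rewrite innerBr innerZr orth mulr0 subr0 innerBl innerZl [X in _ - _ * X]innerC.
by rewrite mulrBl mulrAC divfK// normCK.
Qed.

Lemma CauchySchwarz_inner u v : `|'[u, v]| <= `|u| * `|v|.
Proof.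
have [t tE] := inner_sqr_min u v.
rewrite -(@ler_pXn2r _ 2)// ?nnegrE ?mulr_ge0// exprMn -subr_ge0 -tE.
by rewrite mulr_ge0 ?exprn_ge0.
Qed.

(** Positive elements of [R[i]] are real, so tolerances can be taken in [R]. *)
Lemma pos_complexP (e : R[i]) : 0 < e -> exists2 r : R, 0 < r & e = r%:C%C.
Proof.
move=> e0; have eE : (complex.Re e)%:C%C = e by rewrite RRe_real ?gtr0_real.
by exists (complex.Re e); rewrite ?eE// -ltcR eE.
Qed.

Lemma norm_real u : exists2 r : R, 0 <= r & `|u| = r%:C%C.
Proof.
have uE : (complex.Re `|u|)%:C%C = `|u| by rewrite RRe_real ?normr_real.
by exists (complex.Re `|u|); rewrite ?uE// -lecR uE normr_ge0.
Qed.

Lemma le_small_eq0 (z C : R[i]) :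
  (forall e : R, 0 < e -> `|z| <= e%:C%C * C) -> 0 <= C -> z = 0.
Proof.
move=> small; rewrite le_eqVlt => /predU1P[C0|C0].
  by have := small 1 ltr01; rewrite -C0 mulr0 normr_le0 => /eqP.
apply/eqP; rewrite -normr_le0; apply/ler_addgt0Pr => e e0; rewrite add0r.
have [r r0 rE] := pos_complexP (divr_gt0 e0 C0).
by have := small r r0; rewrite -rE divfK// gt_eqF.
Qed.

Lemma closure_normP (V : set H) p :
  closure V p <-> forall e : R, 0 < e -> exists2 v, V v & `|p - v| <= e%:C%C.
Proof.
split=> [Vp e e0|Vp B /nbhs_ballP[e /= e0 eB]].
  have [|v [Vv pv]] := Vp (ball p e%:C%C).
    by apply: nbhsx_ballx; rewrite ltcR.
  by exists v => //; apply/ltW; move: pv; rewrite -ball_normE.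
have [r r0 rE] := pos_complexP e0.
(* Half the radius turns the non-strict bound into membership in the open ball. *)
have [v Vv pv] := Vp (r / 2) (divr_gt0 r0 (ltr0n _ 2)).
exists v; split=> //; apply: eB; rewrite -ball_normE /= rE.
by apply: (le_lt_trans pv); rewrite ltcR; lra.
Qed.

(** The limit inherits the rate [r]: split [x n - l] at an index beyond [n] where the sequence is
    already close to [l]. *)
Lemma ex_limit (x : nat -> H) (r : nat -> R) :
  (forall n m, (n <= m)%N -> `|x n - x m| <= (r n)%:C%C) ->
  (forall e : R, 0 < e -> exists n, r n <= e) ->
  exists l, forall n, `|x n - l| <= (r n)%:C%C.
Proof.
move=> xr r0.
have /cauchy_cvg/cvg_ex[/= l xl] : cauchy (x @ \oo).
  apply: cauchy_exP => _ /pos_complexP[e e0 ->].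
  have [n rn] := r0 (e / 2) (divr_gt0 e0 (ltr0n _ 2)).
  exists (x n); exists n => // m /= nm; rewrite -ball_normE /=.
  by apply: (le_lt_trans (xr _ _ nm)); rewrite ltcR; lra.
exists l => n; apply/ler_addgt0Pr => e e0.
have /cvgrPdist_lt/(_ _ e0)[N _ xN] := xl.
rewrite -(subrKA (x (maxn n N))); apply: (le_trans (ler_normD _ _)).
apply: lerD; first by apply: xr; rewrite leq_maxl.
by rewrite distrC; apply/ltW/xN; rewrite /= leq_maxr.
Qed.

End InnerProduct.

Definition linear_subspace (R : realType) (H : hilbertType R) (V : set H) :=
  V 0 /\ forall (a : R[i]) u v, V u -> V v -> V (a *: u + v).

(** * Orthogonal projections and Riesz representation *)

Section Projection.
Variables (R : realType) (H : hilbertType R).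

(* Any [v] whose squared distance to [x] is within [e^2] of the infimum works. *)
Lemma almost_orthogonal (V : set H) (x : H) (e : R) :
  linear_subspace V -> 0 < e ->
  exists2 v, V v & forall w, V w -> `|'[x - v, w]| <= e%:C%C * `|w|.
Proof.
move=> [V0 VP] e0.
pose D := [set d : R | exists2 v, V v & `|x - v| ^+ 2 = d%:C%C].
have sqr_real v : exists2 d : R, 0 <= d & `|x - v| ^+ 2 = d%:C%C.
  have [r r0 ->] := norm_real (x - v).
  by exists (r ^+ 2); rewrite ?exprn_ge0// rmorphXn.
have D_lb : has_lbound D.
  exists 0 => d [v _ vd]; have [d' d'0] := sqr_real v.
  by rewrite vd => -[->].
have D_inf : has_inf D.
  by split=> //; have [d _ dE] := sqr_real 0; exists d; exists 0.
have [d [v Vv vd] d_lt] := inf_adherent (exprn_gt0 2 e0) D_inf.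
(* The competitor [v + t *: w], with the optimal [t], lies in [V] and so cannot beat the infimum;
   this bounds the drop in squared distance, which is [|'[x - v, w]|^2 / |w|^2] for nonzero [w], by
   [e^2]. *)
exists v => // w Vw; have [t tE] := inner_sqr_min (x - v) w.
have [d' _ d'E] := sqr_real (v + t *: w).
have : inf D <= d'.
  by apply: ge_inf => //; exists (v + t *: w); rewrite // addrC; exact: VP.
rewrite -lecR -d'E opprD addrA => le_d'.
have eC0 : 0 <= e%:C%C :> R[i] by rewrite ler0c ltW.
rewrite -(@ler_pXn2r _ 2)// ?nnegrE ?mulr_ge0// exprMn.
have -> : `|'[x - v, w]| ^+ 2 = (d%:C%C - `|x - v - t *: w| ^+ 2) * `|w| ^+ 2.
  by rewrite mulrBl tE vd; ring.
rewrite ler_wpM2r ?exprn_ge0// lerBlDr -rmorphXn/=.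
apply: le_trans (lerD (lexx _) le_d').
by rewrite -rmorphD/= lecR addrC ltW.
Qed.

(** Take almost orthogonal [v n] with tolerance [1 / (n + 1)]. For [w = v n - v m], [|w|^2 =
    '[x - v m, w] - '[x - v n, w]], so the sequence is Cauchy with rate [2 / (n + 1)]; its limit is
    the projection. *)
Lemma projection_exists (V : set H) (x : H) :
  linear_subspace V -> exists p, orthogonal_projection (closure V) (x, p).
Proof.
move=> lV; have inv_gt0 n : (0 : R) < n.+1%:R^-1 by rewrite invr_gt0.
have [v vP] : {v : nat -> H & forall n, V (v n) /\
    forall w, V w -> `|'[x - v n, w]| <= (n.+1%:R^-1)%:C%C * `|w|}.
  apply: (@choice _ _ (fun n v => V v /\
    forall w, V w -> `|'[x - v, w]| <= (n.+1%:R^-1)%:C%C * `|w|)) => n.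
  by have [v] := almost_orthogonal x lV (inv_gt0 n); exists v.
have VB u w : V u -> V w -> V (u - w).
  by move=> Vu Vw; rewrite addrC -scaleN1r; apply: lV.2.
have small (e : R) : 0 < e -> exists n, 2 * n.+1%:R^-1 <= e.
  move=> e0; exists (Num.truncn (2 / e)).
  by rewrite ler_pdivrMr// mulrC -ler_pdivrMr// ltW// truncnS_gt.
have [n m nm|e e0|l lP] := @ex_limit _ _ v (fun n => 2 * n.+1%:R^-1).
  have [Vn nP] := vP n; have [Vm mP] := vP m.
  set w := v n - v m; have Vw : V w by exact: VB.
  have [->|w0] := eqVneq w 0; first by rewrite normr0 ler0c mulr_ge0 ?ltW.
  rewrite -(@ler_pM2r _ `|w|) ?normr_gt0// -expr2 -inner_normE.
  have -> : '[w, w] = '[x - v m, w] - '[x - v n, w].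
    by rewrite -innerBl opprB addrC addrA subrK.
  rewrite -[X in X <= _]ger0_norm; last first.
    by rewrite -innerBl opprB addrC addrA subrK inner_normE exprn_ge0.
  apply: (le_trans (ler_normB _ _)).
  apply: (le_trans (lerD (mP _ Vw) (nP _ Vw))).
  rewrite -mulrDl ler_wpM2r// -rmorphD lecR mulr2n mulrDl mul1r lerD2r.
  by rewrite lef_pV2 ?posrE// ler_nat.
  exact: small.
have lv (e : R) : 0 < e -> exists2 n, n.+1%:R^-1 <= e & `|v n - l| <= e%:C%C.
  move=> /small[n n_le]; exists n.
    by apply: le_trans n_le; rewrite ler_peMl ?ler1n// ltW.
  by apply: (le_trans (lP n)); rewrite lecR.
(* Orthogonality is first obtained against [V], splitting [x - l] at [v n]; Cauchy-Schwarz then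
   extends it to the closure. *)
have orthV w : V w -> '[x - l, w] = 0.
  move=> Vw; apply: (@le_small_eq0 _ _ (2 * `|w|)) => [e e0|]; last first.
    by rewrite mulr_ge0.
  have [n n_le vl] := lv e e0.
  have -> : x - l = (x - v n) + (v n - l) by rewrite addrA subrK.
  rewrite innerDl; apply: (le_trans (ler_normD _ _)).
  apply: (le_trans (lerD ((vP n).2 _ Vw) (CauchySchwarz_inner _ _))).
  rewrite [_ * (2 * _)]mulrCA mulrDl !mul1r.
  by rewrite lerD// ler_wpM2r// lecR.
exists l; split=> /=.
  by apply/closure_normP => e /lv[n _ ?]; exists (v n); rewrite 1?distrC//; case: (vP n).
move=> u /closure_normP Vu.
apply: (@le_small_eq0 _ _ `|x - l|) => // e e0; have [w Vw uw] := Vu e e0.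
rewrite -[u](subrK w) innerDr (orthV w)// addr0 mulrC.
by apply: (le_trans (CauchySchwarz_inner _ _)); rewrite ler_wpM2l.
Qed.

Lemma orthogonal_projection_id (V : set H) x :
  V x -> orthogonal_projection V (x, x).
Proof. by move=> Vx; split=> //= v _; rewrite subrr inner0l. Qed.

(* Riesz: a nonzero functional is represented by a multiple of [z], the
   component of any non-null vector orthogonal to the kernel. *)
Lemma bounded_functional_inner (f : H -> R[i]) (M : R[i]) :
  (forall (a : R[i]) u v, f (a *: u + v) = a * f u + f v) ->
  (forall u, `|f u| <= M * `|u|) ->
  exists w, forall u, f u = '[u, w].
Proof.
move=> fP fM.
have f0 : f 0 = 0 by apply/eqP; rewrite -normr_le0 (le_trans (fM 0))// normr0 mulr0.
have [[x fx]|f_eq0] := pselect (exists x, f x != 0); last first.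
  exists 0 => u; rewrite inner0r; apply/eqP/negP => fu.
  by apply: f_eq0; exists u; apply/negP.
pose V : set H := [set u | f u = 0].
have lV : linear_subspace V.
  by split=> // a u v; rewrite /V /= fP => -> ->; rewrite mulr0 addr0.
have [p [/= /closure_normP Vp orth]] := projection_exists x lV.
have fB u v : f (u - v) = f u - f v.
  by rewrite addrC -scaleN1r fP mulN1r addrC.
have M0 : 0 <= M.
  have x0 : x != 0 by apply: contraNneq fx => ->; rewrite f0.
  by have := le_trans (normr_ge0 _) (fM x); rewrite pmulr_lge0// normr_gt0.
(* A priori [p] lies only in the closure of the kernel; the bound on [f] puts it in the kernel. *)
have fp : f p = 0.
  apply: (@le_small_eq0 _ _ M) => // e e0; have [v Vv pv] := Vp e e0.
  have <- : f (p - v) = f p by rewrite fB Vv subr0.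
  by apply: (le_trans (fM _)); rewrite mulrC ler_wpM2r.
set z := x - p in orth; have fz : f z = f x by rewrite fB fp subr0.
have z0 : z != 0 by apply: contraNneq fx; rewrite -fz => ->; rewrite f0.
have zz0 : '[z, z] != 0 by apply/eqP => /inner_eq0/eqP; rewrite (negPf z0).
exists (Num.conj (f z / '[z, z]) *: z) => u; rewrite innerZr conjCK.
(* This vector lies in the kernel, hence is orthogonal to [z]; solving that relation for [f u] gives
   the representation. *)
have Vu : closure V (f u *: z + - f z *: u).
  apply: subset_closure; rewrite /V /= fP -[- f z *: u]addr0 fP f0 addr0.
  by rewrite mulNr mulrC subrr.
have := orth _ Vu; rewrite innerDr !innerZr.
rewrite [X in _ * X + _]innerC [X in _ + _ * X]innerC -!rmorphM -rmorphD.
move/eqP; rewrite conjC_eq0 mulNr subr_eq0 => /eqP fuz.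
by rewrite mulrAC -fuz mulfK.
Qed.
End Projection.

(** * Uniform boundedness principle *)

Section UniformBoundedness.
Variables (R : realType) (H : hilbertType R).

(** Since [2 b = (a + b) - (a - b)], the two vectors on the right cannot both be shorter than
    [b]. *)
Lemma ler_norm_sign (a b : R[i]) : exists s : bool, `|b| <= `|a + (-1) ^+ s * b|.
Proof.
have [le_b|] := boolP (`|b| <= `|a + b|); first by exists false; rewrite expr0 mul1r.
rewrite -real_ltNge ?normr_real// => lt_b; exists true; rewrite expr1 mulN1r.
rewrite real_leNgt ?normr_real//; apply/negP => /(ltrD lt_b).
have -> : `|b| + `|b| = `|(a + b) - (a - b)|.
  by rewrite (_ : _ - _ = b *+ 2) ?normrMn ?mulr2n//; ring.
by move/lt_le_trans => /(_ _ (ler_normB _ _)); rewrite ltxx.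
Qed.

(* Gliding hump: were [c n] an element of [S] of norm at least
   [2 (n + 1) 3^n], a series of vectors [+- 3^-n c n / |c n|], with signs chosen
   so that no cancellation occurs, would pair unboundedly with the [c n]. *)
Lemma weakly_bounded_bounded (S : set H) :
  (forall x, exists M : R, forall c, S c -> `|'[x, c]| <= M%:C%C) ->
  exists M : R, forall c, S c -> `|c| <= M%:C%C.
Proof.
move=> wS; apply: contrapT => unbounded.
pose r n : R := 3^-1 ^+ n.
have r0 n : 0 < r n by rewrite /r exprn_gt0 ?invr_gt0.
have rS n : r n.+1 = r n / 3 by rewrite /r exprSr.
have [c cP] : {c : nat -> H & forall n,
    S (c n) /\ (2 * n.+1%:R / r n)%:C%C < `|c n|}.
  apply: (@choice _ _ (fun n c => S c /\ (2 * n.+1%:R / r n)%:C%C < `|c|)) => n.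
  apply: contrapT => nc; apply: unbounded; exists (2 * n.+1%:R / r n) => c Sc.
  rewrite real_leNgt ?normr_real//; last by apply/complex_realP; eexists.
  by apply/negP => lt_c; apply: nc; exists c.
have c0 n : 0 < `|c n|.
  apply: le_lt_trans (cP n).2.
  by rewrite ler0c divr_ge0 ?mulr_ge0 ?ler0n ?(ltW (r0 n)).
pose h n := ((r n)%:C%C / `|c n|) *: c n.
have rC0 n : 0 <= (r n)%:C%C :> R[i] by rewrite ler0c ltW.
have hN n : `|h n| = (r n)%:C%C.
  rewrite normrZ ger0_norm ?divr_ge0//; first by rewrite divfK// gt_eqF.
have hc n : '[h n, c n] = (r n)%:C%C * `|c n|.
  by rewrite innerZl inner_normE expr2 mulrA divfK// gt_eqF.
(* The sign may depend on the partial sum [x] reached so far, so that adding the next term never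
   makes the pairing with [c n] smaller than that of the term alone. *)
have [s sP] : {s : nat -> H -> bool & forall n x,
    `|'[h n, c n]| <= `|'[x + (-1) ^+ s n x *: h n, c n]|}.
  have /choice[s sP] : forall nx : nat * H, exists b : bool,
      `|'[h nx.1, c nx.1]| <= `|'[nx.2 + (-1) ^+ b *: h nx.1, c nx.1]|.
    move=> [n x] /=; have [b le_b] := ler_norm_sign '[x, c n] '[h n, c n].
    by exists b; rewrite innerDl [X in _ <= `|_ + X|]innerZl.
  by exists (fun n x => s (n, x)) => n x; exact: sP (n, x).
pose x := fix x n := if n is m.+1 then x m + (-1) ^+ s m (x m) *: h m else 0.
have xS n : `|x n - x n.+1| = (r n)%:C%C.
  by rewrite /= opprD addrA subrr add0r normrN normrZ normrX normrN1 expr1n mul1r.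
(* Telescoped geometric sum of ratio [1/3], whence the factor [3/2]. *)
have xr n m : (n <= m)%N -> `|x n - x m| <= (3 / 2 * (r n - r m))%:C%C.
  elim: m => [|m IHm]; first by rewrite leqn0 => /eqP->; rewrite !subrr normr0 mulr0.
  rewrite leq_eqVlt ltnS => /predU1P[->|/IHm le_nm].
    by rewrite !subrr normr0 mulr0.
  rewrite -(subrKA (x m)); apply: (le_trans (ler_normD _ _)).
  rewrite xS; apply: (le_trans (lerD le_nm (lexx _))).
  by rewrite -rmorphD lecR rS; lra.
have [n m nm|e e0|l lP] := @ex_limit _ _ x (fun n => 3 / 2 * r n).
- by apply: (le_trans (xr _ _ nm)); rewrite lecR; have := r0 m; lra.
- exists (Num.truncn (2 / e)); set n := Num.truncn _.
  have rn : r n <= n.+1%:R^-1.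
    rewrite /r exprVn lef_pV2 ?posrE ?exprn_gt0//.
    by rewrite -[3 ^+ n]natrX ler_nat ltn_expl.
  have : 2 * n.+1%:R^-1 <= e.
    by rewrite ler_pdivrMr// mulrC -ler_pdivrMr// ltW// truncnS_gt.
  have : 0 <= n.+1%:R^-1 :> R by rewrite invr_ge0.
  by move: rn; move: (r n) n.+1%:R^-1 => q t; lra.
have [M MP] := wS l.
(* Here [n + 1 > M]. The tail after [x n.+1] has norm at most [3/2 * r n.+1], half of [r n], so
   [r n * |c n| <= 2 M], against [|c n| > 2 (n + 1) / r n]. *)
set n := Num.truncn M; have [Scn lt_c] := cP n.
have : (r n)%:C%C * `|c n| <= (3 / 2 * r n.+1)%:C%C * `|c n| + M%:C%C.
  rewrite -hc -[X in X <= _]ger0_norm ?hc ?mulr_ge0// -hc.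
  apply: (le_trans (sP n (x n))).
  rewrite -[X in '[X, _]](subrK l) innerDl; apply: (le_trans (ler_normD _ _)).
  rewrite lerD ?MP//; apply: (le_trans (CauchySchwarz_inner _ _)).
  by rewrite ler_wpM2r// (lP n.+1).
have [N N0 cN] := norm_real (c n); rewrite cN -!rmorphM -rmorphD lecR rS.
move: lt_c; rewrite cN ltcR ltr_pdivrMr//.
have := truncnS_gt M; rewrite -/n; set t := n.+1%:R; move: (r n) => q.
nra.
Qed.

(** A Hellinger-Toeplitz argument: the adjoint images [h] of the unit ball are weakly bounded, as
    [|'[x, h]| = |'[S x, k]| <= |S x|], hence bounded in norm. *)
Lemma bounded_of_adjoint (K : hilbertType R) (S : set (H * K)) :
  linear_operator S -> op_dom S = setT -> op_dom (op_adjoint S) = setT ->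
  bounded_operator S.
Proof.
move=> lS domS domSa; split=> //.
pose C := [set h : H | exists2 k, `|k| <= 1 & op_adjoint S (k, h)].
have [x|M CM] := @weakly_bounded_bounded C.
  have [y Sxy] : op_dom S x by rewrite domS.
  have [M _ yM] := norm_real y; exists M => c [k k1 Sc].
  rewrite -(Sc _ _ Sxy) /= -yM; apply: (le_trans (CauchySchwarz_inner _ _)).
  by rewrite ler_piMr.
have lk (k : K) : `|k| <= 1 -> forall x y, S (x, y) -> `|'[y, k]| <= M%:C%C * `|x|.
  move=> k1 x y Sxy; have [h Skh] : op_dom (op_adjoint S) k by rewrite domSa.
  rewrite (Skh _ _ Sxy) mulrC; apply: (le_trans (CauchySchwarz_inner _ _)).
  by rewrite ler_wpM2l//; apply: CM; exists k.
exists M => x y Sxy; have [->|y0] := eqVneq y 0.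
  by rewrite normr0; apply: le_trans (lk 0 _ _ _ Sxy); rewrite ?normr0.
have ny : 0 < `|y| by rewrite normr_gt0.
(* The unit vector along [y] recovers [|y|] from the pairings. *)
have := lk (`|y|^-1 *: y) _ _ _ Sxy; rewrite normrZ normfV normr_id mulVf ?gt_eqF//.
move=> /(_ (lexx _)); rewrite innerZr normrM norm_conjC normfV normr_id.
by rewrite inner_normE normrX normr_id expr2 mulKf// gt_eqF.
Qed.
End UniformBoundedness.

(** * Linear relations, adjoints and resolvents *)

Section LinearRelations.
Variable R : realType.
Implicit Types H K L : hilbertType R.

Definition single_valued H K (S : set (H * K)) :=
  forall x y y', S (x, y) -> S (x, y') -> y = y'.

(** Reduces each operator identity of the theorem to one inclusion; equality of domains comes for
    free. *)
Lemma eq_total_single_valued H K (S T : set (H * K)) :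
  op_dom S = setT -> single_valued T -> S `<=` T -> S = T.
Proof.
move=> domS Tf ST; apply/seteqP; split=> // -[x y] Txy.
have [y' Sxy'] : op_dom S x by rewrite domS.
by rewrite (Tf _ _ _ Txy (ST _ Sxy')).
Qed.

Lemma single_valued_sub H K (S T : set (H * K)) :
  single_valued S -> single_valued T -> single_valued (S - T)%OP.
Proof.
move=> Sf Tf x _ _ [u [v [/= Su Tv ->]]] [u' [v' [/= Su' Tv' ->]]].
by rewrite (Sf _ _ _ Su Su') (Tf _ _ _ Tv Tv').
Qed.

Lemma single_valued_comp H K L (S : set (K * L)) (T : set (H * K)) :
  single_valued S -> single_valued T -> single_valued (S * T)%OP.
Proof.
move=> Sf Tf x z z' [y /= Txy Syz] [y' /= Txy' Syz'].
by rewrite (Tf _ _ _ Txy Txy') in Syz; exact: Sf Syz Syz'.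
Qed.

Lemma single_valued_adjoint H K (S : set (H * K)) :
  op_dom S = setT -> single_valued (op_adjoint S).
Proof.
move=> domS k h h' Sh Sh'; apply: inner_inj => x.
have [y Sxy] : op_dom S x by rewrite domS.
by rewrite -(Sh _ _ Sxy) -(Sh' _ _ Sxy).
Qed.

Lemma single_valued_graph H K (f : H -> K) : single_valued (op_graph f).
Proof. by move=> x y y'; rewrite /op_graph /= => -> ->. Qed.

(** For two values [p], [q] at [x], [p - q = (x - q) - (x - p)], and both terms are orthogonal to
    [p] and [q]. *)
Lemma single_valued_projection H (V : set H) :
  single_valued (orthogonal_projection V).
Proof.
move=> x p q [/= Vp xp] [/= Vq xq]; apply/subr0_eq/inner_eq0.
have pqE : p - q = (x - q) - (x - p) by rewrite opprB [RHS]addrC addrA subrK.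
by rewrite {1}pqE innerBl !innerBr !xp ?xq// !subr0.
Qed.

Lemma single_valued_pair H K L (S : set (H * K)) (T : set (H * L)) :
  single_valued S -> single_valued T -> single_valued (op_pair S T).
Proof.
move=> Sf Tf x [y z] [y' z'] [/= Sy Tz] [/= Sy' Tz'].
by rewrite (Sf _ _ _ Sy Sy') (Tf _ _ _ Tz Tz').
Qed.

Lemma linear_operator_comp H K L (S : set (K * L)) (T : set (H * K)) :
  linear_operator S -> linear_operator T -> linear_operator (S * T)%OP.
Proof.
move=> [S0 SP Sf] [T0 TP Tf]; split.
- by exists 0.
- move=> a p q [u Tu Su] [v Tv Sv].
  by exists (a *: u + v); [exact: TP Tu Tv|exact: SP Su Sv].
- exact: single_valued_comp.
Qed.

Lemma linear_operator_pair H K L (S : set (H * K)) (T : set (H * L)) :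
  linear_operator S -> linear_operator T -> linear_operator (op_pair S T).
Proof.
move=> [S0 SP Sf] [T0 TP Tf]; split.
- by split.
- by move=> a p q [Sp Tp] [Sq Tq]; split; [exact: SP Sp Sq|exact: TP Tp Tq].
- exact: single_valued_pair.
Qed.

Lemma linear_operator_adjoint H K (S : set (H * K)) :
  op_dom S = setT -> linear_operator (op_adjoint S).
Proof.
move=> domS; split; last exact: single_valued_adjoint.
- by move=> x y _; rewrite !inner0r.
- move=> a p q Sp Sq x y Sxy.
  by rewrite !innerDr !innerZr (Sp _ _ Sxy) (Sq _ _ Sxy).
Qed.

Lemma linear_subspace_dom_adjoint H K (S : set (H * K)) :
  linear_subspace (op_dom (op_adjoint S)).
Proof.
split; first by exists 0 => x y _; rewrite !inner0r.
move=> a u v [w Sw] [t St]; exists (a *: w + t) => x y Sxy.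
by rewrite !innerDr !innerZr (Sw _ _ Sxy) (St _ _ Sxy).
Qed.

Lemma linear_subspace_image H K (S : set (H * K)) (V : set H) :
  linear_operator S -> linear_subspace V -> linear_subspace (op_image S V).
Proof.
move=> [S0 SP _] [V0 VP]; split; first by exists 0.
move=> a u v [x Vx Sxu] [y Vy Syv].
by exists (a *: x + y); [exact: VP|exact: SP Sxu Syv].
Qed.

(** Riesz representation of the functional sending [x] to ['[S x, k]]. *)
Lemma bounded_adjoint_total H K (S : set (H * K)) :
  bounded_operator S -> op_dom (op_adjoint S) = setT.
Proof.
move=> [[_ SP Sf] domS [M SM]]; apply/seteqP; split=> // k _.
have /choice[f Sxf] : forall x, exists y, S (x, y).
  by move=> x; have : op_dom S x by rewrite domS.
have [||w fw] := @bounded_functional_inner _ _ (fun x => '[f x, k]) (M%:C%C * `|k|).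
- move=> a u v; rewrite -innerZl -innerDl; congr '[_, k].
  by apply: Sf (Sxf _) _; exact: SP (Sxf u) (Sxf v).
- move=> u; apply: (le_trans (CauchySchwarz_inner _ _)).
  by rewrite mulrAC ler_wpM2r// SM.
by exists w => x y Sxy; rewrite (Sf _ _ _ Sxy (Sxf x)) fw.
Qed.

Lemma resolventP H (A : set (H * H)) (z : R[i]) x y :
  resolvent A z (x, y) <-> A (y, x + z *: y).
Proof.
split=> [[u [v [/= Au]]]|Ay]; first by rewrite /op_graph /= => -> ->; rewrite subrK.
by exists (x + z *: y), (z *: y); rewrite addrK.
Qed.

(** Membership of [(x, y)] on either side says ['[u - z *: b, y] = '[b, x]] for all [(b, u)] in [A],
    so the equality already holds for graphs. *)
Lemma resolvent_adjoint H (A : set (H * H)) (z : R[i]) :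
  resolvent (op_adjoint A) (Num.conj z) = op_adjoint (resolvent A z).
Proof.
apply/seteqP; split=> -[x y].
- move=> /resolventP Ay a b /resolventP/Ay /=.
  by rewrite innerDl innerZl innerDr innerZr conjCK => /addIr.
- move=> Rxy; apply/resolventP => b u Abu /=; rewrite innerDr innerZr conjCK.
  rewrite (Rxy (u - z *: b) b) /=; first by rewrite innerBl innerZl subrK.
  by apply/resolventP; rewrite subrK.
Qed.
End LinearRelations.

(** * Traces composed with the resolvent of the adjoint *)

Section KreinFormula.
Variables (R : realType) (H hh kk : hilbertType R).
Variables (A At : set (H * H)) (G0 : set (H * hh)) (G1 : set (H * kk)).
Variables (Gt0 : set (H * kk)) (Gt1 : set (H * hh)) (A2 : set (H * H)).
Variable zeta : R[i].
Hypothesis triplet : boundary_triplet A At G0 G1 Gt0 Gt1.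
Hypothesis AA2 : A `<=` A2.

Local Notation R2 := (resolvent A2 zeta).
Local Notation R2s := (resolvent (op_adjoint A2) (Num.conj zeta)).
Local Notation Tt := (op_pair Gt0 Gt1).

(** Adjoints reverse [A <= A2], so the range of [R2s] lies in the domain of the traces [Gt0],
    [Gt1]. *)
Lemma resolvent_adjoint_sub y v : R2s (y, v) ->
  op_adjoint A (v, y + Num.conj zeta *: v).
Proof.
by move=> /resolventP A2v a b /AA2; exact: A2v.
Qed.

(* Green's identity against [v = R2s y], for which [A^* v = y + conj zeta v]. *)
Lemma traces_adjoint u f r g0 g1 :
  op_adjoint At (u, f) -> G0 (u, g0) -> G1 (u, g1) ->
  R2 (f - zeta *: u, r) ->
  ((Tt * R2s)^*)%OP ((g1, - g0) : hsum kk hh, r - u).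
Proof.
move=> Atu Gu0 Gu1 R2r y [t0 t1] [v /= R2sv [/= tv0 tv1]].
have := triplet_Green triplet Atu (resolvent_adjoint_sub R2sv) Gu0 Gu1 tv0 tv1.
(* As [R2s] is the adjoint of [R2], ['[r, y] = '[f - zeta *: u, v]]. Conjugation then moves the test
   vector to the first slot, as [op_adjoint] requires. *)
move: R2sv; rewrite resolvent_adjoint => /(_ _ _ R2r) /= rE.
rewrite innerDr innerZr conjCK opprD addrA addrAC -innerZl -innerBl -rE -innerBl.
rewrite hsum_innerE/= linearNr => /(congr1 (@Num.conj _)).
by rewrite -innerC rmorphB/= -!innerC => <-.
Qed.

Hypothesis R2_bounded : bounded_operator R2.

Lemma resolvent_adjoint_total : op_dom R2s = setT.
Proof. by rewrite resolvent_adjoint; exact: bounded_adjoint_total. Qed.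

Lemma trace_resolvent_total (x : H) : exists v t0 t1,
  [/\ R2s (x, v), Gt0 (v, t0) & Gt1 (v, t1)].
Proof.
have [v R2sv] : op_dom R2s x by rewrite resolvent_adjoint_total.
have Av : op_dom (op_adjoint A) v.
  by eexists; exact: resolvent_adjoint_sub R2sv.
have [_ _ dom0 dom1] := triplet_dom triplet.
have [t0 vt0] : op_dom Gt0 v by rewrite dom0.
have [t1 vt1] : op_dom Gt1 v by rewrite dom1.
by exists v, t0, t1.
Qed.

Lemma trace_resolvent_dom : [/\ op_dom (Gt0 * R2s)%OP = setT,
  op_dom (Gt1 * R2s)%OP = setT & op_dom (Tt * R2s)%OP = setT].
Proof.
by split; apply/seteqP; split=> // x _;
  have [v [t0 [t1 [? ? ?]]]] := trace_resolvent_total x;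
  [exists t0|exists t1|exists (t0, t1)]; exists v.
Qed.

Lemma trace_resolvent_adjoint_total : op_dom ((Tt * R2s)^*)%OP = setT.
Proof.
apply/seteqP; split=> // -[k1 k2] _.
(* The prescribed trace is the preimage of [(k1, k2)] under [symplectic_swap]. *)
have [u _ [/= Gu0 Gu1]] : op_image (op_pair G0 G1) setT ((- k2, k1) : hsum hh kk).
  by rewrite (triplet_trace_surj triplet).
have [f Atu] : op_dom (op_adjoint At) u.
  by have [<- _ _ _] := triplet_dom triplet; exists (- k2).
have [r R2r] : op_dom R2 (f - zeta *: u) by case: R2_bounded => _ ->.
by exists (r - u); have := traces_adjoint Atu Gu0 Gu1 R2r; rewrite opprK.
Qed.

(** Pairing with [(k, 0)] sees only the first trace. Single-valuedness of [R2s] ensures that the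
    vector carrying both traces at [x] is the given [v]. *)
Lemma trace_resolvent_adjointl k h :
  ((Tt * R2s)^*)%OP ((k, 0) : hsum kk hh, h) -> ((Gt0 * R2s)^*)%OP (k, h).
Proof.
move=> Tkh x t0 [v /= R2sv vt0].
have [w [_ [t1 [R2sw _ wt1]]]] := trace_resolvent_total x.
have vw : w = v.
  move: R2sv R2sw; rewrite resolvent_adjoint => R2sv R2sw.
  by apply: single_valued_adjoint R2sw R2sv; case: R2_bounded.
rewrite -(Tkh x (t0, t1)); last by exists v => //; split; rewrite // -vw.
by rewrite hsum_innerE /= inner0r addr0.
Qed.

Lemma trace_resolvent_adjointr k h :
  ((Tt * R2s)^*)%OP ((0, k) : hsum kk hh, h) -> ((Gt1 * R2s)^*)%OP (k, h).
Proof.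
move=> Tkh x t1 [v /= R2sv vt1].
have [w [t0 [_ [R2sw wt0 _]]]] := trace_resolvent_total x.
have vw : w = v.
  move: R2sv R2sw; rewrite resolvent_adjoint => R2sv R2sw.
  by apply: single_valued_adjoint R2sw R2sv; case: R2_bounded.
rewrite -(Tkh x (t0, t1)); last by exists v => //; split; rewrite // -vw.
by rewrite hsum_innerE /= inner0r add0r.
Qed.

Lemma trace_resolvent_bounded : bounded_operator (Tt * R2s)%OP.
Proof.
have [_ _ lGt0 lGt1] := triplet_linear triplet.
have [_ domR2 _] := R2_bounded.
have [_ _ domT] := trace_resolvent_dom.
apply: bounded_of_adjoint domT trace_resolvent_adjoint_total.
apply: linear_operator_comp; first exact: linear_operator_pair.
by rewrite resolvent_adjoint; exact: linear_operator_adjoint.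
Qed.

End KreinFormula.

(** * The two formulas for the resolvent difference *)

Theorem theorem6p2 (R : realType) (H hh kk : hilbertType R)
    (A At : set (H * H))
    (G0 : set (H * hh)) (G1 : set (H * kk))
    (Gt0 : set (H * kk)) (Gt1 : set (H * hh))
    (A1 A2 : set (H * H)) (zeta : R[i]) :
  adjoint_pair A At ->
  boundary_triplet A At G0 G1 Gt0 Gt1 ->
  linear_operator A1 -> closed A1 -> A `<=` A1 -> A1 `<=` op_adjoint At ->
  linear_operator A2 -> closed A2 -> A `<=` A2 -> A2 `<=` op_adjoint At ->
  (~` (spectrum A1 `|` spectrum A2)) zeta ->
  let T := op_pair G0 G1 in
  let Tt := op_pair Gt0 Gt1 in
  let R1 := resolvent A1 zeta in
  let R2 := resolvent A2 zeta in
  let R2s := resolvent (op_adjoint A2) (Num.conj zeta) in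
  let Q1 := orthogonal_projection (closure (op_image T (op_dom A1))) in
  let Q2 := orthogonal_projection
              (closure (op_image Tt (op_dom (op_adjoint A2)))) in
  let J := op_graph (@symplectic_swap R hh kk) in
  [/\ (R2 - R1 = (Gt0 * R2s)^* * (G1 * R1) - (Gt1 * R2s)^* * (G0 * R1))%OP,
      bounded_operator (Tt * R2s)%OP &
      (R2 - R1 = (Tt * R2s)^* * Q2 * J * Q1 * (T * R1))%OP].
Proof.
move=> _ triplet _ _ _ A1At _ _ AA2 _ /not_orP[/contrapT R1_bd /contrapT R2_bd].
move=> T Tt R1 R2 R2s Q1 Q2 J.
have [[_ _ R1f] domR1 _] := R1_bd; have [[_ _ R2f] domR2 _] := R2_bd.
have [[_ _ G0f] [_ _ G1f] lGt0 lGt1] := triplet_linear triplet.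
have [domG0 domG1 domGt0 domGt1] := triplet_dom triplet.
have [dom0 dom1 domT] := trace_resolvent_dom triplet AA2 R2_bd.
have adjf := single_valued_adjoint domT.
have bdT := trace_resolvent_bounded triplet AA2 R2_bd.
have domD : op_dom (R2 - R1)%OP = setT.
  apply/seteqP; split=> // x _.
  have [r2 R2x] : op_dom R2 x by rewrite domR2.
  have [r1 R1x] : op_dom R1 x by rewrite domR1.
  by exists (r2 - r1), r2, r1.
(* Data shared by both formulas: with [u = R1 x] and [f = x + zeta *: u], the vector [f - zeta *: u]
   is [x] and [r2 - u] is the resolvent difference. *)
have diffP x y : (R2 - R1)%OP (x, y) -> exists u g0 g1,
    [/\ A1 (u, x + zeta *: u), R1 (x, u), G0 (u, g0), G1 (u, g1) &
        ((Tt * R2s)^*)%OP ((g1, - g0) : hsum kk hh, y)].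
  move=> [r2 [u [/= R2x R1x ->]]]; have /resolventP A1u := R1x.
  have Atu := A1At _ A1u.
  have [g0 Gu0] : op_dom G0 u by rewrite domG0; exists (x + zeta *: u).
  have [g1 Gu1] : op_dom G1 u by rewrite domG1; exists (x + zeta *: u).
  exists u, g0, g1; split=> //.
  by apply: (traces_adjoint triplet AA2 Atu Gu0 Gu1); rewrite addrK.
split=> //.
- apply: (eq_total_single_valued domD) => [|[x y] /diffP].
    by apply: single_valued_sub; apply: single_valued_comp;
      first [exact: single_valued_adjoint | exact: single_valued_comp].
  move=> [u [g0 [g1 [A1u R1x Gu0 Gu1 Ty]]]].
  have Tat := trace_resolvent_adjoint_total triplet AA2 R2_bd.
  (* The adjoint is evaluated separately on the parts of [(g1, - g0) = (g1, 0) - (0, g0)]; its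
     single-valuedness then gives [y = a - b]. *)
  have [a Ta] : op_dom (op_adjoint (Tt * R2s)%OP) ((g1, 0) : hsum kk hh).
    by rewrite Tat.
  have [b Tb] : op_dom (op_adjoint (Tt * R2s)%OP) ((0, g0) : hsum kk hh).
    by rewrite Tat.
  exists a, b; split=> /=.
  + exists g1; first by exists u.
    exact: (trace_resolvent_adjointl triplet AA2 R2_bd).
  + exists g0; first by exists u.
    exact: (trace_resolvent_adjointr triplet AA2 R2_bd).
  + apply: adjf Ty _ => z t Tzt.
    rewrite innerBr -(Ta _ _ Tzt) -(Tb _ _ Tzt) !hsum_innerE /= !inner0r linearNr.
    by rewrite addr0 add0r.
- apply: (eq_total_single_valued domD) => [|[x y] /diffP].
    do ![apply: single_valued_comp] => //.
    + exact: single_valued_projection.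
    + exact: single_valued_graph.
    + exact: single_valued_projection.
    + exact: single_valued_pair.
  move=> [u [g0 [g1 [A1u R1x Gu0 Gu1 Ty]]]].
  have lGt := linear_operator_pair lGt0 lGt1.
  have lV : linear_subspace (op_image Tt (op_dom (op_adjoint A2))).
    exact/linear_subspace_image/linear_subspace_dom_adjoint.
  have [q Q2q] := projection_exists ((g1, - g0) : hsum kk hh) lV.
  (* The witnesses follow [x] successively through [T * R1], [Q1], [J] and [Q2]. *)
  exists ((g0, g1) : hsum hh kk) => /=; first by exists u.
  exists ((g0, g1) : hsum hh kk) => /=.
    apply: orthogonal_projection_id; apply: subset_closure.
    by exists u => //; exists (x + zeta *: u).
  exists ((g1, - g0) : hsum kk hh) => //.
  (* The trace of [v = R2s z] lies in the subspace to which [(g1, - g0) - q] is orthogonal, so [q]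
     and [(g1, - g0)] pair equally with it. *)
  exists q => // z t [v /= R2sv Tv]; rewrite -(Ty z t); last by exists v.
  apply/esym/eqP; rewrite -subr_eq0 -innerBr innerC; apply/eqP.
  have [_ ->] := Q2q; rewrite ?rmorph0//.
  apply: subset_closure; exists v => //.
  by exists (z + Num.conj zeta *: v); apply/resolventP.
Qed.
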